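(* Let $p$ be a prime, $a$ a complex number, and for a finite abelian group $F$ let $\sigma_a(F)=\sum_{H\le F}|H|^a$ (sum over all subgroups $H$ of $F$). Let $F_r$ be a finite abelian $p$-group of rank $r\ge1$ and exponent $p^\ell$. Let $e_\ell\in F_r$ be an element of order $p^\ell$ and let $F_{r-1}$ be a subgroup of $F_r$ such that $F_r=F_{r-1}\oplus\mathbb{Z}e_\ell$. Then $$(p^a-1)\,\sigma_a(F_r)=p^{a\ell+a}\,|F_{r-1}|\,\sigma_{a-1}(F_{r-1})-\sigma_{a+1}(F_{r-1}).$$ *)

(* Defs.v *)
From mathcomp Require Import all_boot all_order all_algebra all_fingroup.
From mathcomp Require Import all_solvable.
From mathcomp Require Import complex reals sequences exp trigo.

Set Implicit Arguments.
Unset Strict Implicit.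
Unset Printing Implicit Defensive.

Local Open Scope ring_scope.
Local Open Scope complex_scope.

Definition cexp (R : realType) (z : R[i]) : R[i] :=
  (expR (Re z))%:C * (cos (Im z) +i* sin (Im z)).

(* n ^ a = exp (a log n) with the real logarithm of n > 0; since ln 0 = 0 in
   the library, the value at n = 0 is the irrelevant 1. *)
Definition natCpow (R : realType) (n : nat) (a : R[i]) : R[i] :=
  cexp (a * (ln (n%:R : R))%:C).

Definition sigma (R : realType) (gT : finGroupType) (a : R[i])
    (F : {group gT}) : R[i] :=
  \sum_(H in subgroups F) natCpow #|H| a.

(* Main.v *)
Require Import Defs.
From mathcomp Require Import all_boot all_order all_algebra all_fingroup.
From mathcomp Require Import all_solvable all_field all_character.
From mathcomp Require Import complex reals exp trigo.
From mathcomp Require Import ring.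

Set Implicit Arguments.
Unset Strict Implicit.
Unset Printing Implicit Defensive.

Import GRing.Theory Num.Theory.

Local Open Scope group_scope.

(* Let F = A \x <[e]> with #[e] = n. The subgroups H of F with H :&: A = K
   correspond to the subgroups of F / K that meet A / K trivially; those of
   order d are the <[y * b]>, where b is a fixed element of order d of the
   image of <[e]> and y runs over the elements of A / K with #[y] %| d. So
     \sum_(H <= F) f #|H|
       = \sum_(K <= A) \sum_(y in A / K) \sum_(d | #[y] %| d %| n) f (#|K| * d).
   If n = p ^ l and f (p * m) = c * f m, then multiplying by c - 1 makes the
   inner sum telescope to f (#|K| * p ^ l.+1) - f (#|K| * #[y]). In the second
   term #|K| * #[y] is the order of the preimage L of <[y]>, and each L <= A
   arises from exactly #|L| pairs (K, y): for each K the generators of L / K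
   are as many as its faithful characters, that is, as the characters of L
   with kernel K. *)

Lemma divisors_pfactor (p l : nat) :
  prime p -> divisors (p ^ l) = [seq (p ^ i)%N | i <- iota 0 l.+1].
Proof.
move=> p_pr; apply: (irr_sorted_eq ltn_trans ltnn) => [ | | d].
- exact: sorted_divisors_ltn.
- apply: homo_sorted (iota_ltn_sorted _ _) => i j.
  by rewrite ltn_exp2l ?prime_gt1.
rewrite -dvdn_divisors ?expn_gt0 ?prime_gt0 //.
apply/idP/mapP => [/(dvdn_pfactor _ _ p_pr)[i le_il ->] | [i i_lt ->]].
  by exists i; rewrite // mem_iota.
by rewrite mem_iota in i_lt; rewrite dvdn_exp2l.
Qed.

Lemma partition_big_seq (R : Type) (idx : R) (op : Monoid.com_law idx)
    (I : finType) (J : eqType) (s : seq J) (P : pred I) (p : I -> J)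
    (F : I -> R) :
    uniq s -> (forall i, P i -> p i \in s) ->
  \big[op/idx]_(i | P i) F i
    = \big[op/idx]_(j <- s) \big[op/idx]_(i | P i && (p i == j)) F i.
Proof.
move=> uniq_s P_s; rewrite (exchange_big_dep P) /= => [|j i _ /andP[] //].
apply: eq_bigr => i Pi; rewrite -big_filter Pi /=.
rewrite (eq_filter (eq_sym (p i))) filter_pred1_uniq ?P_s //.
by rewrite big_seq1.
Qed.

Section FaithfulCharacters.

Local Open Scope ring_scope.
Local Open Scope group_scope.

Variable gT : finGroupType.
Implicit Types (x : gT) (G : {group gT}).

Lemma cfaithful_lin_cycle x (chi : 'CF(<[x]>)) :
    chi \is a linear_char ->
  cfaithful chi = (#[x]%g.-primitive_root (chi x))%R.
Proof.
move=> lin_chi.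
have chiX m : (chi x ^+ m = chi (x ^+ m)%g)%R by rewrite lin_charX ?cycle_id.
apply/idP/idP => [fful_chi | prim_chi_x].
  have [m prim_m dv_m] :=
    prim_order_exists (order_gt0 x) (lin_char_unity_root lin_chi (cycle_id x)).
  suff /eqP <- : m == #[x] by [].
  rewrite eqn_dvd dv_m order_dvdn; apply/eqP.
  apply: (fful_lin_char_inj lin_chi fful_chi); rewrite ?mem_cycle //.
  by rewrite -chiX (prim_expr_order prim_m) lin_char1.
rewrite cfaithfulE; apply/subsetP=> y.
rewrite (cfkerEchar (lin_charW lin_chi)) !inE lin_char1 //.
case/andP=> /cycleP[m ->]; rewrite -chiX.
by rewrite -(prim_order_dvd prim_chi_x) order_dvdn.
Qed.

Lemma card_fful_irr_cyclic G :
  cyclic G -> #|[set i | cfaithful 'chi[G]_i]| = totient #|G|.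
Proof.
move=> cycG; have [x defG] := cyclicP cycG.
move/group_inj: defG cycG => -> cycx; rewrite -orderE.
have lin_chi (i : Iirr <[x]>) : 'chi_i \is a linear_char.
  exact: irr_cyclic_lin.
have [z prim_z] := C_prim_root_exists (order_gt0 x).
have /fin_all_exists[k chi_x] (i : Iirr <[x]>) :
    exists k : 'I_#[x], ('chi_i x = z ^+ k)%R.
  have /(prim_rootP prim_z)[k ->] : ('chi_i x ^+ #[x]%g = 1)%R.
    by rewrite lin_char_unity_root ?cycle_id.
  by exists k.
have inj_k : injective k.
  move=> i j eq_k; apply/irr_inj/cfun_inP => _ /cycleP[m ->].
  by rewrite !lin_charX ?cycle_id // !chi_x eq_k.
have bij_k : bijective k.
  by apply: inj_card_bij; rewrite // card_ord card_Iirr_cyclic.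
rewrite totient_count_coprime big_mkord -big_mkcond /= sum1dep_card.
rewrite -(on_card_preimset (onW_bij _ bij_k)); apply: eq_card => i.
rewrite !inE cfaithful_lin_cycle // chi_x prim_root_exp_coprime //.
by rewrite coprime_sym.
Qed.

Lemma card_generator G :
  #|[set x | generator G x]| = if cyclic G then totient #|G| else 0%N.
Proof.
have [/cyclicP[x ->] | ncycG] := ifPn; first by rewrite -totient_gen.
apply/eqP; rewrite cards_eq0 -subset0; apply/subsetP=> x.
by rewrite inE => /eqP defG; case/cyclicP: ncycG; exists x.
Qed.

Lemma card_fful_irr_abelian G :
    abelian G ->
  #|[set i | cfaithful 'chi[G]_i]| = #|[set x | generator G x]|.
Proof.
move=> abG; rewrite card_generator.
have [/card_fful_irr_cyclic // | ncycG] := ifPn.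
apply/eqP; rewrite cards_eq0 -subset0; apply/subsetP=> i.
by rewrite inE => /irr_faithful_center; rewrite (center_idP abG) (negPf ncycG).
Qed.

End FaithfulCharacters.

Lemma card_cfker_irr (gT : finGroupType) (G K : {group gT}) :
    K <| G ->
  #|[set i | cfker ('chi[G]_i)%R == K]|
    = #|[set i | cfaithful ('chi[G / K]_i)%R]|.
Proof.
move=> nsKG; have bij_mod := mod_Iirr_bij nsKG.
rewrite -(on_card_preimset (f := @mod_Iirr _ G K)); last first.
  by apply: subon_bij bij_mod => i; rewrite !inE => /eqP <-.
apply: eq_card => i; rewrite !inE mod_IirrE // cfaithfulE.
rewrite eqEsubset cfker_mod // andbT -quotient_sub1 ?(quotient_cfker_mod G) //.
exact: subset_trans (cfker_sub _) (normal_norm nsKG).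
Qed.

Lemma sum_card_generator_quotient (gT : finGroupType) (G : {group gT}) :
    abelian G ->
  (\sum_(K in subgroups G) #|[set y | generator (G / K) y]| = #|G|)%N.
Proof.
move=> abG; rewrite -(card_Iirr_abelian abG) -sum1_card.
rewrite (partition_big (fun i => cfker_group ('chi[G]_i)%R)
                       (mem (subgroups G))) /=.
  apply: eq_bigr => K; rewrite inE => sKG.
  rewrite sum1dep_card card_cfker_irr -?sub_abelian_normal //.
  by rewrite card_fful_irr_abelian ?quotient_abelian.
by move=> i _; rewrite inE cfker_sub.
Qed.

Lemma sum_cycle_generator (V : nmodType) (gT : finGroupType) (G : {group gT})
    (h : {group gT} -> V) :
  (\sum_(x in G) h <[x]>%G
   = \sum_(H in subgroups G) h H *+ #|[set x | generator H x]|)%R.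
Proof.
rewrite (partition_big (fun x => <[x]>%G) (mem (subgroups G))) /=; last first.
  by move=> x Gx; rewrite inE /= cycle_subG.
apply: eq_bigr => H; rewrite inE => sHG; rewrite -sumr_const.
apply: eq_big => [x | x /andP[_ /eqP->] //].
rewrite inE /generator -val_eqE eq_sym andb_idl //= => /eqP defH.
by rewrite -cycle_subG -defH.
Qed.

Lemma sum_subgroups_quotient (V : nmodType) (gT : finGroupType)
    (G K : {group gT}) (F : {group coset_of K} -> V) :
    K <| G ->
  (\sum_(M in subgroups (G / K)) F M
   = \sum_(L in subgroups G | K \subset L) F (L / K)%G)%R.
Proof.
move=> nsKG; rewrite [RHS](reindex_onto
  (fun M : {group coset_of K} => coset K @*^-1 M)%G (fun L => L / K)%G).
  have preK (M : {group coset_of K}) : (coset K @*^-1 M / K)%G = M.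
    by apply/val_inj; rewrite /= cosetpreK.
  apply: eq_big => M; last by rewrite preK.
  by rewrite preK eqxx andbT !inE sub_cosetpre sub_cosetpre_quo ?andbT.
move=> L /andP[]; rewrite inE => sLG sKL; apply/val_inj.
by rewrite /= quotientGK // (normalS sKL sLG).
Qed.

Lemma sum_card_cosetpre_cycle (V : nmodType) (gT : finGroupType)
    (G : {group gT}) (f : nat -> V) :
    abelian G ->
  (\sum_(K in subgroups G) \sum_(y in (G / K)%g) f (#|K| * #[y])%N
   = \sum_(L in subgroups G) f #|L| *+ #|L|)%R.
Proof.
move=> abG.
transitivity (\sum_(K in subgroups G) \sum_(L in subgroups G | K \subset L)
    f #|L| *+ #|[set y | generator (L / K) y]|)%R.
  apply: eq_bigr => K; rewrite inE => sKG.
  have nsKG : K <| G by rewrite -sub_abelian_normal.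
  rewrite (sum_cycle_generator (G / K)%G (fun M => f (#|K| * #|M|)%N)).
  rewrite sum_subgroups_quotient //; apply: eq_bigr => L /andP[].
  rewrite inE => sLG sKL; congr (f _ *+ _)%R.
  rewrite card_quotient ?Lagrange //.
  exact: subset_trans sLG (normal_norm nsKG).
rewrite (exchange_big_dep (mem (subgroups G))) /=; last first.
  by move=> K L _ /andP[].
apply: eq_bigr => L; rewrite inE => sLG; rewrite sumrMnr; congr (_ *+ _)%R.
rewrite -(sum_card_generator_quotient (abelianS sLG abG)).
apply: eq_bigl => K; rewrite !inE sLG andb_idl // => sKL.
exact: subset_trans sLG.
Qed.

Section DirectProduct.

Variables (gT : finGroupType) (G A B : {group gT}).
Hypothesis defG : A \x B = G.
Implicit Types (y b : gT) (H : {group gT}).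

Lemma expg_dprod y b n :
  y \in A -> b \in B -> (y * b) ^+ n = y ^+ n * b ^+ n.
Proof.
have [_ _ cAB _] := dprodP defG => Ay Bb.
by apply/expgMn/esym/(centsP cAB).
Qed.

Lemma mem_expg_dprodl y b n :
  y \in A -> b \in B -> ((y * b) ^+ n \in A) = (b ^+ n == 1).
Proof.
have [_ _ _ tiAB] := dprodP defG => Ay Bb; rewrite expg_dprod //.
rewrite (groupMl _ (groupX n Ay)); apply/idP/eqP => [Abn | ->].
  by apply/set1gP; rewrite -tiAB inE Abn groupX.
exact: group1.
Qed.

Section OrderDividing.

Variables y b : gT.
Hypotheses (Ay : y \in A) (Bb : b \in B) (dv_yb : #[y] %| #[b]).

Lemma expg_dprod_eq1 n : ((y * b) ^+ n == 1) = (b ^+ n == 1).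
Proof.
apply/eqP/eqP => [ybn1 | bn1].
  by apply/eqP; rewrite -(mem_expg_dprodl n Ay Bb) ybn1.
rewrite expg_dprod // bn1 mulg1; apply/eqP.
by rewrite -order_dvdn (dvdn_trans dv_yb) // order_dvdn bn1.
Qed.

Lemma order_dprod : #[y * b] = #[b].
Proof.
apply/eqP; rewrite eqn_dvd !order_dvdn expg_dprod_eq1 expg_order eqxx.
by rewrite -expg_dprod_eq1 expg_order eqxx.
Qed.

Lemma cycle_dprod_TI : <[y * b]> :&: A = 1.
Proof.
apply/trivgP/subsetP=> x /setIP[/cycleP[n ->]].
by rewrite mem_expg_dprodl // inE expg_dprod_eq1.
Qed.

End OrderDividing.

Lemma cycle_dprod_inj b : b \in B ->
  {in [pred y in A | #[y] %| #[b]] &, injective (fun y => <[y * b]>)}.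
Proof.
move=> Bb y z /andP[Ay dv_yb] /andP[Az _] /= eq_cycles.
apply/eqP; rewrite eq_mulgV1; apply/eqP/set1gP.
rewrite -(cycle_dprod_TI Ay Bb dv_yb); apply/setIP; split; last first.
  by rewrite groupM ?groupV.
have -> : y * z^-1 = (y * b) * (z * b)^-1 by rewrite invMg mulgA mulgK.
have zb : z * b \in <[y * b]> by rewrite eq_cycles cycle_id.
by rewrite groupM ?groupV ?cycle_id.
Qed.

Lemma card_setI_join_dprod H :
  H \subset G -> H :&: A = 1 -> #|B :&: (A <*> H)| = #|H|.
Proof.
move=> sHG tiHA; have [nsAG _] := dprod_normal2 defG.
have nAH : H \subset 'N(A) := subset_trans sHG (normal_norm nsAG).
have sAHG : A <*> H \subset G by rewrite join_subG sHG normal_sub.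
have := dprod_card (dprod_modl defG (joing_subl A H)).
rewrite /= (setIidPr sAHG) [in RHS]norm_joinEr // TI_cardMg 1?setIC //.
by move/eqP; rewrite eqn_pmul2l // => /eqP.
Qed.

End DirectProduct.

Section CyclicDirectFactor.

Variables (gT : finGroupType) (G A : {group gT}) (e : gT).
Hypothesis defG : A \x <[e]> = G.
Implicit Types (b : gT) (H : {group gT}).

Lemma TI_sub_dprod_cycle H b :
    b \in <[e]> -> H \subset G -> H :&: A = 1 -> #|H| = #[b] ->
  exists2 y, y \in [pred y in A | #[y] %| #[b]] & H = <[y * b]>%G.
Proof.
move=> Bb sHG tiHA oH; have [nsAG _] := dprod_normal2 defG.
have nAH : H \subset 'N(A) := subset_trans sHG (normal_norm nsAG).
have defb : <[e]> :&: (A <*> H) = <[b]>.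
  apply/eqP; rewrite (eq_subG_cyclic (cycle_cyclic e)) ?subsetIl ?cycle_subG //.
  by rewrite (card_setI_join_dprod defG) // oH.
have : b \in A * H by rewrite -norm_joinEr // -cycle_subG -defb subsetIr.
case/mulsgP=> z h Az Hh def_b.
have def_h : h = z^-1 * b by rewrite def_b mulKg.
have Ay : z^-1 \in A by rewrite groupV.
have dv_yb : #[z^-1] %| #[b].
  have : (z^-1 * b) ^+ #[b] = 1 by rewrite -def_h -oH expg_cardG.
  by rewrite (expg_dprod defG) // expg_order mulg1 => /eqP; rewrite -order_dvdn.
exists z^-1; first by rewrite inE Ay.
apply/val_inj/eqP; rewrite /= eq_sym eqEcard cycle_subG -def_h Hh /=.
by rewrite def_h oH -orderE (order_dprod defG).
Qed.

Lemma card_TI_subgroups_dprod_cycle b :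
    b \in <[e]> ->
  #|[set H in subgroups G | (H :&: A == 1) && (#|H| == #[b])]|
    = #|[pred y in A | #[y] %| #[b]]|.
Proof.
move=> Bb; have [nsAG nsBG] := dprod_normal2 defG.
rewrite -(card_in_imset (f := fun y => <[y * b]>%G) _); last first.
  move=> y z Cy Cz /(congr1 val); exact: cycle_dprod_inj defG _ Bb _ _ Cy Cz.
apply: eq_card => H; rewrite !inE; apply/idP/imsetP.
  case/and3P=> sHG /eqP tiHA /eqP oH.
  exact: TI_sub_dprod_cycle.
case=> y /andP[Ay dv_yb] ->.
rewrite cycle_subG /= -orderE (cycle_dprod_TI defG) //.
rewrite (order_dprod defG) // !eqxx !andbT.
rewrite groupM ?(subsetP (normal_sub nsAG) y) //.
exact: subsetP (normal_sub nsBG) b Bb.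
Qed.

Lemma sum_TI_subgroups_dprod_cycle (V : nmodType) (f : nat -> V) :
  (\sum_(H in subgroups G | H :&: A == 1%g) f #|H|
   = \sum_(y in A) \sum_(d <- divisors #[e]%g | (#[y]%g %| d)%N) f d)%R.
Proof.
have order_divides (H : {group gT}) :
    (H \in subgroups G) && (H :&: A == 1) -> #|H| \in divisors #[e].
  rewrite inE => /andP[sHG /eqP tiHA].
  rewrite -dvdn_divisors // -(card_setI_join_dprod defG sHG tiHA).
  by rewrite cardSg ?subsetIl.
rewrite (partition_big_seq _ _ (divisors_uniq #[e]) order_divides).
rewrite [RHS](exchange_big_dep predT) //=; apply: eq_big_seq => d.
rewrite -dvdn_divisors // => dv_d.
have [b eb ob] : exists2 b, b \in <[e]> & #[b] = d.
  exists (e ^+ (#[e] %/ d)); first exact: mem_cycle.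
  by rewrite orderXdiv ?dvdn_div // divnA // mulKn.
transitivity (f d *+ #|[pred y in A | (#[y]%g %| d)%N]|)%R; last first.
  by rewrite -sumr_const; apply: eq_bigl => y; rewrite inE.
rewrite -ob -card_TI_subgroups_dprod_cycle // -sumr_const.
by apply: eq_big => [H | H /andP[_ /eqP->] //]; rewrite !inE andbA.
Qed.

End CyclicDirectFactor.

Lemma quotient_dprod (gT : finGroupType) (G A B K : {group gT}) :
    A \x B = G -> K <| G -> K \subset A ->
  (A / K) \x (B / K) = G / K.
Proof.
move=> defG nsKG sKA; have [_ mulAB cAB tiAB] := dprodP defG.
have [nsAG _] := dprod_normal2 defG.
rewrite dprodE ?quotient_cents //.
  rewrite -quotientMl ?mulAB //.
  exact: subset_trans (normal_sub nsAG) (normal_norm nsKG).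
by rewrite -quotientGI // tiAB quotient1.
Qed.

Lemma order_coset_TI (gT : finGroupType) (K : {group gT}) (x : gT) :
  x \in 'N(K) -> K :&: <[x]> = 1 -> #[coset K x] = #[x].
Proof.
move=> nKx tiKx; rewrite !orderE -quotient_cycle //; apply/esym/card_isog.
by rewrite quotient_isog ?cycle_subG.
Qed.

Section AbelianCyclicDirectFactor.

Variables (V : nmodType) (gT : finGroupType) (G A : {group gT}) (e : gT).
Hypotheses (abG : abelian G) (defG : A \x <[e]> = G).
Variable f : nat -> V.

Lemma sum_subgroups_meet_dprod_cycle (K : {group gT}) :
    K \subset A ->
  (\sum_(H in subgroups G | (H :&: A)%G == K) f #|H|
   = \sum_(y in (A / K)%g)
       \sum_(d <- divisors #[e]%g | (#[y]%g %| d)%N) f (#|K| * d)%N)%R.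
Proof.
move=> sKA; have [_ _ _ tiAe] := dprodP defG.
have [/normal_sub sAG /normal_sub] := dprod_normal2 defG.
rewrite cycle_subG => Ge.
have nsKG : K <| G by rewrite -sub_abelian_normal ?(subset_trans sKA).
have nKG := normal_norm nsKG; have nKe := subsetP nKG e Ge.
have defGK : A / K \x <[coset K e]> = G / K.
  by rewrite -quotient_cycle // (quotient_dprod defG).
have -> : #[e] = #[coset K e].
  rewrite order_coset_TI //.
  by apply/trivgP; rewrite -tiAe setSI.
rewrite -(sum_TI_subgroups_dprod_cycle defGK (fun d => f (#|K| * d)%N)).
rewrite [RHS]big_mkcondr sum_subgroups_quotient // -big_mkcondr /=.
apply: eq_big => [L | L /andP[]]; rewrite inE; last first.
  move=> sLG /eqP defK; have sKL : K \subset L by rewrite -defK subsetIl.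
  by rewrite card_quotient ?Lagrange // (subset_trans sLG).
rewrite -andbA; apply: andb_id2l => sLG; rewrite -val_eqE /=.
rewrite [in LHS]eqEsubset subsetI sKA andbT andbC; apply: andb_id2l => sKL.
rewrite -quotientIG // -subG1 quotient_sub1 //.
by rewrite (subset_trans (subsetIr _ _)) // (subset_trans sAG).
Qed.

Lemma sum_subgroups_dprod_cycle :
  (\sum_(H in subgroups G) f #|H|
   = \sum_(K in subgroups A) \sum_(y in (A / K)%g)
       \sum_(d <- divisors #[e]%g | (#[y]%g %| d)%N) f (#|K| * d)%N)%R.
Proof.
rewrite (partition_big (fun H => H :&: A)%G (mem (subgroups A))) /=.
  apply: eq_bigr => K; rewrite inE; exact: sum_subgroups_meet_dprod_cycle.
by move=> H _; rewrite inE subsetIr.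
Qed.

End AbelianCyclicDirectFactor.

Local Close Scope group_scope.
Local Open Scope ring_scope.

Lemma telescope_pfactor_multiples (R : pzRingType) (f : nat -> R) (c : R)
    (p l j m : nat) :
    prime p -> (forall n, (0 < n)%N -> f (p * n)%N = c * f n) ->
    (0 < m)%N -> (j <= l)%N ->
  (c - 1) * (\sum_(d <- divisors (p ^ l) | (p ^ j %| d)%N) f (m * d)%N)
    = f (m * p ^ l.+1)%N - f (m * p ^ j)%N.
Proof.
move=> p_pr f_pM m_gt0 le_jl; rewrite divisors_pfactor // big_map.
rewrite -[iota _ _]/(index_iota 0 l.+1) (eq_bigl (leq j)) => [|i]; last first.
  by rewrite dvdn_Pexp2l ?prime_gt1.
rewrite -(big_nat_widenl _ _ _ predT) // mulr_sumr.
apply: (telescope_sumr_eq (fun i => f (m * p ^ i)%N)) => [|i _].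
  exact: leqW.
by rewrite mulrBl mul1r expnS mulnCA f_pM // muln_gt0 m_gt0 expn_gt0 prime_gt0.
Qed.

Lemma sum_subgroups_dprod_pcycle (R : pzRingType) (f : nat -> R) (c : R)
    (p l : nat) (gT : finGroupType) (G A : {group gT}) (e : gT) :
    prime p -> (forall n, (0 < n)%N -> f (p * n)%N = c * f n) ->
    abelian G -> (exponent A %| p ^ l)%N -> #[e]%g = (p ^ l)%N ->
    (A \x <[e]>)%g = G ->
  (c - 1) * \sum_(H in subgroups G) f #|H|
    = \sum_(K in subgroups A) f (#|K| * p ^ l.+1)%N *+ #|A : K|%g
      - \sum_(L in subgroups A) f #|L| *+ #|L|.
Proof.
move=> p_pr f_pM abG expA oe defG.
have [/normal_sub sAG _] := dprod_normal2 defG.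
have abA := abelianS sAG abG.
rewrite (sum_subgroups_dprod_cycle abG defG) oe mulr_sumr.
rewrite -sum_card_cosetpre_cycle // -sumrB.
apply: eq_bigr => K; rewrite inE => sKA.
have nKA : (A \subset 'N(K))%g by rewrite sub_abelian_norm.
rewrite -card_quotient // -sumr_const -sumrB mulr_sumr.
apply: eq_bigr => y AKy.
have : (#[y]%g %| p ^ l)%N.
  apply: dvdn_trans (dvdn_exponent AKy) _.
  exact: dvdn_trans (exponent_quotient _ _) expA.
case/(dvdn_pfactor _ _ p_pr) => j le_jl ->.
exact: telescope_pfactor_multiples.
Qed.

Local Open Scope complex_scope.

Section ComplexPowers.

Variable R : realType.
Implicit Types (a b z w : R[i]) (m n k : nat).

Lemma cexpD z w : cexp (z + w) = cexp z * cexp w.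
Proof.
case: z w => [a b] [c d]; rewrite /cexp /= expRD cosD sinD.
by apply/eqP; rewrite eq_complex /=; apply/andP; split; apply/eqP; ring.
Qed.

Lemma natCpowD n a b : natCpow n (a + b) = natCpow n a * natCpow n b.
Proof. by rewrite /natCpow mulrDl cexpD. Qed.

Lemma natCpowM m n a :
  (0 < m)%N -> (0 < n)%N -> natCpow (m * n) a = natCpow m a * natCpow n a.
Proof.
move=> m_gt0 n_gt0; rewrite /natCpow natrM lnM ?qualifE/= ?ltr0n //.
by rewrite rmorphD mulrDr cexpD.
Qed.

Lemma natCpowX n k a :
  (0 < n)%N -> natCpow (n ^ k) a = natCpow n (a * k%:R).
Proof.
move=> n_gt0; rewrite /natCpow natrX lnXn ?ltr0n // rmorphMn.
by rewrite -mulrA mulr_natl.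
Qed.

Lemma natCpow1 n : (0 < n)%N -> natCpow n 1 = n%:R :> R[i].
Proof.
move=> n_gt0; rewrite /natCpow mul1r /cexp /= lnK ?qualifE/= ?ltr0n //.
by rewrite cos0 sin0 complexr0 mulr1 rmorph_nat.
Qed.

Lemma natCpowD1 n a : (0 < n)%N -> natCpow n (a + 1) = natCpow n a * n%:R.
Proof. by move=> n_gt0; rewrite natCpowD natCpow1. Qed.

End ComplexPowers.

Local Close Scope complex_scope.
Local Close Scope ring_scope.

Theorem theorem3p1 (R : realType) (p : nat) (p_prime : prime p) (a : R[i])
    (gT : finGroupType) (F F' : {group gT}) (r l : nat) (e : gT)
    (F_abelian : abelian F) (F_pgroup : (p.-group F)%g)
    (F_rank : ('r(F))%g = r) (r_ge1 : (1 <= r)%N)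
    (F_exponent : exponent F = (p ^ l)%N)
    (e_in_F : e \in F) (e_order : #[e]%g = (p ^ l)%N)
    (F'_sub_F : F' \subset F) (F_decomp : (F' \x <[e]>)%g = F) :
  ((natCpow p a - 1) * sigma a F =
    natCpow p (a * l%:R + a) * #|F'|%:R * sigma (a - 1) F'
      - sigma (a + 1) F')%R.
Proof.
have p_gt0 := prime_gt0 p_prime.
have expF' : (exponent F' %| p ^ l)%N by rewrite -F_exponent exponentS.
have pow_pM n : 0 < n -> (natCpow (p * n) a = natCpow p a * natCpow n a)%R.
  exact: natCpowM.
rewrite /sigma (sum_subgroups_dprod_pcycle p_prime pow_pM F_abelian expF'
                  e_order F_decomp).
congr (_ - _)%R; last first.
  by apply: eq_bigr => L _; rewrite natCpowD1 // mulr_natr.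
rewrite mulr_sumr; apply: eq_bigr => K; rewrite inE => sKF'.
have -> : (a * l%:R + a = a * l.+1%:R)%R by rewrite mulrSr mulrDr mulr1.
have powK : natCpow #|K| a = (natCpow #|K| (a - 1) * #|K|%:R)%R.
  by rewrite -natCpowD1 // subrK.
rewrite natCpowM ?expn_gt0 ?p_gt0 // natCpowX // powK -(Lagrange sKF') natrM.
rewrite -mulr_natr; move: (natCpow p _) (natCpow #|K| _) => u v; ring.
Qed.
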